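(* Let $A_i, B_i, S_i, T_i, X\in B(\mathcal H)$, $i=1,2$, and let $m_1,m_2,n_1,n_2,r_1,r_2,s_1,s_2$ be positive integers such that (i) $[A_1,A_2]=[B_1,B_2]=0$ and $[A_i,T_i]=[B_i,S_i]=0$ for $i=1,2$; (ii) $((B_1,A_1),(B_2,A_2))\in$ left-$(X,(m_1,n_1))$-symmetric; (iii) $((S_1,T_1),(B_2,A_2))\in$ left-$(X,(r_1,n_2))$-symmetric; (iv) $((B_1,A_1),(S_2,T_2))\in$ left-$(X,(m_2,s_1))$-symmetric; (v) $((S_1,T_1),(S_2,T_2))\in$ left-$(X,(r_2,s_2))$-symmetric. Then $$((S_1B_1,T_1A_1),(S_2B_2,T_2A_2))\in \text{left-}(X,(m+r-1,n+s-1))\text{-symmetric},$$ where $m=\max(m_1,m_2)$, $n=\max(n_1,n_2)$, $r=\max(r_1,r_2)$ and $s=\max(s_1,s_2)$.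
   Context: $\mathcal H$ is an infinite dimensional complex Hilbert space, $B(\mathcal H)$ the algebra of bounded linear operators on $\mathcal H$, and $[A,B]=AB-BA$. For $A,B\in B(\mathcal H)$, $L_A(X)=AX$ and $R_B(X)=XB$ denote left and right multiplication acting on $B(\mathcal H)$. For a positive integer $k$ set $$\triangle_{B,A}^k(X)=(L_BR_A-I)^k(X)=\sum_{j=0}^k(-1)^j\binom{k}{j}B^{k-j}XA^{k-j},\qquad \delta_{B,A}^k(X)=(L_B-R_A)^k(X)=\sum_{j=0}^k(-1)^j\binom{k}{j}B^{k-j}XA^{j}.$$ For operators $C_1,C_2,D_1,D_2,X\in B(\mathcal H)$ and positive integers $m,n$, the assertion $((D_1,C_1),(D_2,C_2))\in$ left-$(X,(m,n))$-symmetric means that $[C_1,C_2]=[D_1,D_2]=0$ and $$\triangle^m_{D_1,C_1}\big(\delta^n_{D_2,C_2}(X)\big)=\delta^n_{D_2,C_2}\big(\triangle^m_{D_1,C_1}(X)\big)=0$$ (the first equality being automatic from the commutation relations). In particular hypotheses such as $((S_1,T_1),(B_2,A_2))\in$ left-$(X,(r_1,n_2))$-symmetric include $[T_1,A_2]=[S_1,B_2]=0$. *)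

(* Defs.v *)
From HB Require Import structures.
From mathcomp Require Import all_boot all_order all_algebra.
From mathcomp Require Import sesquilinear complex.
From mathcomp Require Import all_classical all_reals all_analysis.

Set Implicit Arguments.
Unset Strict Implicit.
Unset Printing Implicit Defensive.

Import Order.TTheory GRing.Theory Num.Theory.
Import numFieldNormedType.Exports.

Local Open Scope ring_scope.
Local Open Scope complex_scope.

(* [inner] is linear in its first and conjugate-linear in its second argument. *)
HB.mixin Record CompleteNormedModule_isHilbert (R : realType) H
    of CompleteNormedModule R[i] H := {
  inner : {dot H for (@Num.conj R[i])} ;
  inner_norm : forall x : H, inner x x = `|x| ^+ 2
}.

#[short(type="hilbertType")]
HB.structure Definition Hilbert (R : realType) :=
  {H of CompleteNormedModule_isHilbert R H & CompleteNormedModule R[i] H}.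

Definition infinite_dimensional (R : realType) (H : hilbertType R) : Prop :=
  ~ exists (n : nat) (e : 'I_n -> H),
      forall x : H, exists c : 'I_n -> R[i], x = \sum_(i < n) c i *: e i.

(* The multiplication of the ring [bounded_op H] is composition. *)
Section BoundedOperators.
Context (R : realType) (H : hilbertType R).

Definition bounded_linear : {pred H -> H} := fun f =>
  `[< linear f /\ exists M : R, forall x, `|f x| <= M%:C * `|x| >].

Record bounded_op := BoundedOp {
  bop_fun :> H -> H ;
  _ : bop_fun \in bounded_linear }.

HB.instance Definition _ := [isSub for bop_fun].
HB.instance Definition _ := [Choice of bounded_op by <:].

Lemma bounded_linearP f : reflect
  (linear f /\ exists M : R, forall x, `|f x| <= M%:C * `|x|)
  (f \in bounded_linear).
Proof. exact: asboolP. Qed.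

Lemma bounded_linear_zmod : zmod_closed bounded_linear.
Proof.
split.
  apply/bounded_linearP; split.
    by move=> a x y; rewrite /= scaler0 addr0.
  by exists 0 => x; rewrite normr0 rmorph0 mul0r.
move=> f g /bounded_linearP[lf [M hM]] /bounded_linearP[lg [N hN]].
apply/bounded_linearP; split.
  move=> a x y; rewrite !fctE lf lg scalerBr opprD -!addrA; congr (_ + _).
  by rewrite addrCA.
exists (M + N) => x; rewrite rmorphD mulrDl.
by apply: le_trans (ler_normB _ _) _; exact: lerD.
Qed.

HB.instance Definition _ :=
  GRing.isZmodClosed.Build (H -> H) bounded_linear bounded_linear_zmod.
HB.instance Definition _ := [SubChoice_isSubZmodule of bounded_op by <:].

Lemma bop_linear (A : bounded_op) : linear A.
Proof. by case: A => f fb /=; have /bounded_linearP[] := fb. Qed.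

HB.instance Definition _ (A : bounded_op) :=
  GRing.isLinear.Build R[i] H H _ A (@bop_linear A).

Lemma bop_bounded (A : bounded_op) :
  exists M : R, forall x, `|A x| <= M%:C * `|x|.
Proof. by case: A => f fb /=; have /bounded_linearP[] := fb. Qed.

Lemma bop_ext (A B : bounded_op) : A =1 B -> A = B.
Proof. by move=> /funext AB; exact: val_inj. Qed.

Lemma bop_addE (A B : bounded_op) x : (A + B) x = A x + B x.
Proof. by rewrite -[LHS]/(val (A + B) x) raddfD. Qed.

Lemma id_bounded_linear : idfun \in bounded_linear.
Proof.
by apply/bounded_linearP; split=> //; exists 1 => x; rewrite rmorph1 mul1r.
Qed.

Definition bop_id : bounded_op := BoundedOp id_bounded_linear.

Lemma comp_bounded_linear (A B : bounded_op) : A \o B \in bounded_linear.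
Proof.
apply/bounded_linearP; split; first by move=> a x y; rewrite /= !linearP.
have [M hM] := bop_bounded A; have [N hN] := bop_bounded B.
exists (Num.max M 0 * N) => x /=; apply: le_trans (hM _) _.
rewrite rmorphM -mulrA.
have max0 : 0 <= (Num.max M 0)%:C by rewrite ler0c le_max lexx orbT.
apply: le_trans (_ : (Num.max M 0)%:C * `|B x| <= _).
  by apply: ler_wpM2r => //; rewrite lecR le_max lexx.
exact: ler_wpM2l.
Qed.

Definition bop_comp (A B : bounded_op) : bounded_op :=
  BoundedOp (comp_bounded_linear A B).

Fact bop_compA : associative bop_comp.
Proof. by move=> A B C; exact: bop_ext. Qed.

Fact bop_comp1l : left_id bop_id bop_comp.
Proof. by move=> A; exact: bop_ext. Qed.

Fact bop_comp1r : right_id bop_id bop_comp.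
Proof. by move=> A; exact: bop_ext. Qed.

Fact bop_compDl : left_distributive bop_comp +%R.
Proof.
by move=> A B C; apply: bop_ext => x; rewrite [RHS]bop_addE.
Qed.

Fact bop_compDr : right_distributive bop_comp +%R.
Proof.
by move=> A B C; apply: bop_ext => x; rewrite [RHS]bop_addE; exact: (linearD A).
Qed.

HB.instance Definition _ := GRing.Zmodule_isPzRing.Build bounded_op
  bop_compA bop_comp1l bop_comp1r bop_compDl bop_compDr.

End BoundedOperators.

Lemma iter_subE (V : pzRingType) (f g : {additive V -> V}) k x :
    (forall y, f (g y) = g (f y)) ->
  iter k (f \- g) x =
    \sum_(j < k.+1) (-1) ^+ j * iter (k - j) f (iter j g x) *+ 'C(k, j).
Proof.
move=> fg; have gf i y : g (iter i f y) = iter i f (g y).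
  by elim: i => //= i <-; rewrite fg.
have step i (y : V) n : f ((-1) ^+ i * y *+ n) = (-1) ^+ i * f y *+ n.
  by rewrite raddfMn raddfMsign.
have stepg i (y : V) n : g ((-1) ^+ i * y *+ n) = (-1) ^+ i * g y *+ n.
  by rewrite raddfMn raddfMsign.
elim: k => [|k IH]; first by rewrite big_ord1 /= mul1r.
rewrite iterS IH -[LHS]/(f _ - g _) !raddf_sum /=.
under eq_bigr do rewrite step -iterS.
under [X in _ + X = _]eq_bigr do rewrite stepg gf -iterS.
rewrite [RHS]big_ord_recl [RHS]/=.
under [X in _ = _ + X]eq_bigr => i _ do
  rewrite /bump leq0n add1n binS mulrnDr subSS.
rewrite big_split addrA /=; congr (_ + _); last first.
  by apply: eq_bigr => i _; rewrite exprS mulN1r mulNr mulNrn.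
transitivity (\sum_(j < k.+2)
    (-1) ^+ j * iter (k.+1 - j) f (iter j g x) *+ 'C(k, j)).
  rewrite [RHS]big_ord_recr /= bin_small // mulr0n addr0.
  by apply: eq_bigr => i _; rewrite [in RHS]subSn // -ltnS.
by rewrite big_ord_recl /= !bin0.
Qed.

Section ElementaryOperators.
Context (R : realType) (H : hilbertType R).
Implicit Types A B C D X : bounded_op H.

Definition commutator A B : bounded_op H := A * B - B * A.

Definition lmul A : bounded_op H -> bounded_op H := fun X => A * X.
Definition rmul B : bounded_op H -> bounded_op H := fun X => X * B.

Fact lmul_is_zmod_morphism A : zmod_morphism (lmul A).
Proof. by move=> X Y; exact: mulrBr. Qed.
HB.instance Definition _ A := GRing.isZmodMorphism.Build _ _ (lmul A)
  (lmul_is_zmod_morphism A).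

Fact rmul_is_zmod_morphism B : zmod_morphism (rmul B).
Proof. by move=> X Y; exact: mulrBl. Qed.
HB.instance Definition _ B := GRing.isZmodMorphism.Build _ _ (rmul B)
  (rmul_is_zmod_morphism B).

Definition triangle k B A : bounded_op H -> bounded_op H :=
  iter k ((lmul B \o rmul A) \- idfun).

Definition delta k B A : bounded_op H -> bounded_op H :=
  iter k (lmul B \- rmul A).

Definition left_symmetric X (m n : nat) :
    set ((bounded_op H * bounded_op H) * (bounded_op H * bounded_op H)) :=
  [set p | let: ((D1, C1), (D2, C2)) := p in
    [/\ commutator C1 C2 = 0, commutator D1 D2 = 0,
        triangle m D1 C1 (delta n D2 C2 X) = delta n D2 C2 (triangle m D1 C1 X)
      & delta n D2 C2 (triangle m D1 C1 X) = 0]].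

(* The closed formulas; the (-1) ^+ j are scalars embedded in [bounded_op H]. *)
Lemma triangleE k B A X : triangle k B A X =
  \sum_(j < k.+1) (-1) ^+ j * (B ^+ (k - j) * X * A ^+ (k - j)) *+ 'C(k, j).
Proof.
have itB i Y : iter i (lmul B \o rmul A) Y = B ^+ i * Y * A ^+ i.
  elim: i Y => [|i IH] Y; first by rewrite !expr0 mul1r mulr1.
  by rewrite iterS IH /= /lmul /rmul exprS exprSr !mulrA.
have it1 i (Y : bounded_op H) : iter i idfun Y = Y by elim: i => //= i ->.
rewrite /triangle iter_subE //.
by apply: eq_bigr => j _; rewrite itB it1.
Qed.

Lemma deltaE k B A X : delta k B A X =
  \sum_(j < k.+1) (-1) ^+ j * (B ^+ (k - j) * X * A ^+ j) *+ 'C(k, j).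
Proof.
have itB i Y : iter i (lmul B) Y = B ^+ i * Y.
  by elim: i => [|i IH] /=; rewrite ?expr0 ?mul1r // IH /lmul exprS mulrA.
have itA i Y : iter i (rmul A) Y = Y * A ^+ i.
  by elim: i => [|i IH] /=; rewrite ?expr0 ?mulr1 // IH /rmul exprSr mulrA.
rewrite /delta iter_subE; last by move=> Y; exact: mulrA.
by apply: eq_bigr => j _; rewrite itB itA mulrA.
Qed.

End ElementaryOperators.

(* Main.v *)
Require Import Defs.
From mathcomp Require Import all_boot all_order all_algebra.
From mathcomp Require Import all_classical all_reals all_analysis.

(** All multiplication operators in sight commute: the hypotheses make both
    [A1] and [T1] commute with both [A2] and [T2], and likewise for the [B]s
    and [S]s, while left and right multiplications always commute with each
    other.  Writing
      [P Y = B1 * Y * A1 - Y] and [Q Y = S1 * Y * T1 - Y],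
    one has
      [(S1 * B1) * Y * (T1 * A1) - Y = S1 * P Y * T1 + Q Y],
    and writing
      [P' Y = B2 * Y - Y * A2] and [Q' Y = S2 * Y - Y * T2],
    one has
      [(S2 * B2) * Y - Y * (T2 * A2) = S2 * P' Y + Q' Y * A2].
    So each of the two product operators is a combination [c P + d Q] of
    commuting maps, and, as in the binomial theorem, its power of exponent
    [m + r - 1] kills every vector killed by both [P ^ m] and [Q ^ r]
    ([iter_combination_eq0]).  The four symmetry hypotheses say that
    [P' ^ n] and [Q' ^ s] kill the vectors [P ^ m X] and [Q ^ r X].  Hence
    the power of exponent [n + s - 1] of the second product operator kills
    them too; by commutation, [P ^ m] and [Q ^ r] kill the image of [X] under
    that power, and then so does the power of the first product operator. *)

Import GRing.Theory.

Local Open Scope ring_scope.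

(** * Powers of combinations of commuting additive maps *)

Section CommutingMaps.
Context {V : zmodType}.

Definition commuting (f g : V -> V) := forall x, f (g x) = g (f x).

Lemma commuting_sym {f g} : commuting f g -> commuting g f.
Proof. by move=> fg x; rewrite fg. Qed.

Lemma commuting_comp {f g h} :
  commuting f g -> commuting f h -> commuting f (g \o h).
Proof. by move=> fg fh x; rewrite /= fg fh. Qed.

Lemma commuting_sub {f : {additive V -> V}} {g h} :
  commuting f g -> commuting f h -> commuting f (g \- h).
Proof. by move=> fg fh x; rewrite /= raddfB fg fh. Qed.

Lemma commuting_iter k {f g} : commuting f g -> commuting f (iter k g).
Proof. by move=> fg; elim: k => //= k IH x; rewrite fg IH. Qed.

Lemma iter_raddf0 (f : {additive V -> V}) k : iter k f 0 = 0.
Proof. by elim: k => //= k ->; rewrite raddf0. Qed.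

Lemma iter_raddfD (f : {additive V -> V}) k x y :
  iter k f (x + y) = iter k f x + iter k f y.
Proof. by elim: k => //= k ->; rewrite raddfD. Qed.

Lemma iter_eq0_leq (f : {additive V -> V}) {m} n {x} :
  (m <= n)%N -> iter m f x = 0 -> iter n f x = 0.
Proof. by move=> /subnK <- fx; rewrite iterD fx iter_raddf0. Qed.

Lemma iter_comp_eq0 (f c g : {additive V -> V}) k x :
    commuting f c -> commuting f g -> iter k f x = 0 ->
  iter k f (c (g x)) = 0.
Proof.
move=> fc fg fx; rewrite -(commuting_iter k (commuting_sym fc)).
by rewrite -(commuting_iter k (commuting_sym fg)) fx !raddf0.
Qed.

(** The bound on the nilpotency index of a sum of commuting nilpotents,
    localised at one vector.  In
    [D ^ k.+1 Y = D ^ k (c (P Y)) + D ^ k (d (Q Y))]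
    the vector [c (P Y)] is killed by one power of [P] less than [Y] is, and
    [d (Q Y)] by one power of [Q] less; an induction on [k] therefore
    replaces the binomial expansion. *)
Lemma iter_combination_eq0 (D P Q c d : {additive V -> V}) (p q k : nat) Y :
    (forall y, D y = c (P y) + d (Q y)) ->
    commuting P Q -> commuting P c -> commuting P d ->
    commuting Q c -> commuting Q d ->
    (p + q <= k.+1)%N -> iter p P Y = 0 -> iter q Q Y = 0 ->
  iter k D Y = 0.
Proof.
move=> DE PQ Pc Pd Qc Qd; have QP := commuting_sym PQ.
elim: k p q Y => [|k IH] p q Y.
  (* The bound forces p or q to be 0, and either way Y itself is 0. *)
  case: p => [_ /= -> //|p]; case: q => [_ _ /= -> //|q].
  by rewrite addSn addnS.
case: p => [_ /= -> _|p]; first by rewrite -iterS iter_raddf0.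
case: q => [_ _ /= ->|q]; first by rewrite -iterS iter_raddf0.
move=> lepq PY QY; rewrite iterSr DE iter_raddfD.
rewrite (IH p q.+1) ?(IH p.+1 q) ?addr0 //.
- by rewrite -ltnS -addnS.
- exact: iter_comp_eq0.
- by rewrite -(commuting_iter q (commuting_sym Qd)) -iterSr QY raddf0.
- by rewrite -(commuting_iter p (commuting_sym Pc)) -iterSr PY raddf0.
- exact: iter_comp_eq0.
Qed.

End CommutingMaps.

(** * Commuting multiplications *)

Section Multiplications.
Context {R : realType} {H : hilbertType R}.
Implicit Types A B C D : bounded_op H.

Lemma commutator_eq0 {A B} : commutator A B = 0 -> GRing.comm A B.
Proof. exact: subr0_eq. Qed.

Lemma comm_commutator A B : GRing.comm A B -> commutator A B = 0.
Proof. by rewrite /commutator => ->; rewrite subrr. Qed.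

Lemma commuting_lmul A B : GRing.comm A B -> commuting (lmul A) (lmul B).
Proof. by move=> AB Y; rewrite /lmul !mulrA AB. Qed.

Lemma commuting_rmul A B : GRing.comm A B -> commuting (rmul A) (rmul B).
Proof. by move=> AB Y; rewrite /rmul -!mulrA AB. Qed.

Lemma commuting_lmul_rmul A B : commuting (lmul A) (rmul B).
Proof. by move=> Y; rewrite /lmul /rmul mulrA. Qed.

(** One step of the iterations [triangle] and [delta], bundled as additive maps
    so that the results on powers of additive maps apply. *)
Definition triangle1 B A : {additive bounded_op H -> bounded_op H} :=
  (lmul B \o rmul A) \- idfun.

Definition delta1 B A : {additive bounded_op H -> bounded_op H} :=
  lmul B \- rmul A.

Lemma triangle1_lmul A B C : GRing.comm B C ->
  commuting (triangle1 B A) (lmul C).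
Proof.
move=> BC; apply/commuting_sym/commuting_sub => //.
apply: commuting_comp; last exact: commuting_lmul_rmul.
exact/commuting_lmul/commr_sym.
Qed.

Lemma triangle1_rmul A B C : GRing.comm A C ->
  commuting (triangle1 B A) (rmul C).
Proof.
move=> AC; apply/commuting_sym/commuting_sub => //.
apply: commuting_comp; first exact/commuting_sym/commuting_lmul_rmul.
exact/commuting_rmul/commr_sym.
Qed.

Lemma delta1_lmul A B C : GRing.comm B C -> commuting (delta1 B A) (lmul C).
Proof.
move=> BC; apply/commuting_sym/commuting_sub; last exact: commuting_lmul_rmul.
exact/commuting_lmul/commr_sym.
Qed.

Lemma delta1_rmul A B C : GRing.comm A C -> commuting (delta1 B A) (rmul C).
Proof.
move=> AC; apply/commuting_sym/commuting_sub.
  exact/commuting_sym/commuting_lmul_rmul.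
exact/commuting_rmul/commr_sym.
Qed.

Lemma triangle1_triangle1 A B C D : GRing.comm A C -> GRing.comm B D ->
  commuting (triangle1 B A) (triangle1 D C).
Proof.
move=> AC BD; apply: commuting_sub => //.
by apply: commuting_comp; [exact: triangle1_lmul | exact: triangle1_rmul].
Qed.

Lemma triangle1_delta1 A B C D : GRing.comm A C -> GRing.comm B D ->
  commuting (triangle1 B A) (delta1 D C).
Proof.
move=> AC BD.
by apply: commuting_sub; [exact: triangle1_lmul | exact: triangle1_rmul].
Qed.

Lemma delta1_delta1 A B C D : GRing.comm A C -> GRing.comm B D ->
  commuting (delta1 B A) (delta1 D C).
Proof.
move=> AC BD.
by apply: commuting_sub; [exact: delta1_lmul | exact: delta1_rmul].
Qed.

Lemma triangle1_mul A B S T Y : GRing.comm A T ->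
  triangle1 (S * B) (T * A) Y =
    (lmul S \o rmul T) (triangle1 B A Y) + idfun (triangle1 S T Y).
Proof.
move=> AT; rewrite /= /lmul /rmul mulrBl mulrBr addrA subrK -AT.
by rewrite !mulrA.
Qed.

Lemma delta1_mul A B S T Y :
  delta1 (S * B) (T * A) Y = lmul S (delta1 B A Y) + rmul A (delta1 S T Y).
Proof.
by rewrite /= /lmul /rmul mulrBl mulrBr !mulrA addrA subrK.
Qed.

(** The combination is that of [triangle1_mul], with coefficients
    [Y |-> S * Y * T] and the identity. *)
Lemma triangle_mul_eq0 A B S T p q Y :
    GRing.comm A T -> GRing.comm B S ->
    triangle p B A Y = 0 -> triangle q S T Y = 0 ->
  triangle (p + q - 1) (S * B) (T * A) Y = 0.
Proof.
move=> AT BS; apply: (iter_combination_eq0 (triangle1 (S * B) (T * A))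
  (triangle1 B A) (triangle1 S T) (lmul S \o rmul T) idfun) => //.
- by move=> y; rewrite triangle1_mul.
- exact: triangle1_triangle1.
- by apply: commuting_comp; [exact: triangle1_lmul | exact: triangle1_rmul].
- by apply: commuting_comp; [exact: triangle1_lmul | exact: triangle1_rmul].
- by rewrite subn1 leqSpred.
Qed.

Lemma delta_mul_eq0 A B S T p q Y :
    GRing.comm A T -> GRing.comm B S ->
    delta p B A Y = 0 -> delta q S T Y = 0 ->
  delta (p + q - 1) (S * B) (T * A) Y = 0.
Proof.
move=> AT BS; apply: (iter_combination_eq0 (delta1 (S * B) (T * A))
  (delta1 B A) (delta1 S T) (lmul S) (rmul A)) => //.
- exact: delta1_mul.
- exact: delta1_delta1.
- exact: delta1_lmul.
- exact: delta1_rmul.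
- exact: delta1_lmul.
- exact/delta1_rmul/commr_sym.
- by rewrite subn1 leqSpred.
Qed.

Lemma triangle_delta_comm k l A B C D Y :
    GRing.comm A C -> GRing.comm B D ->
  triangle k B A (delta l D C Y) = delta l D C (triangle k B A Y).
Proof.
move=> AC BD; apply: (commuting_iter l); apply: commuting_sym.
by apply: (commuting_iter k); apply/commuting_sym/triangle1_delta1.
Qed.

Lemma triangle_eq0_leq p k B A Y :
  (p <= k)%N -> triangle p B A Y = 0 -> triangle k B A Y = 0.
Proof. exact: (iter_eq0_leq (triangle1 B A)). Qed.

Lemma delta_eq0_leq p k B A Y :
  (p <= k)%N -> delta p B A Y = 0 -> delta k B A Y = 0.
Proof. exact: (iter_eq0_leq (delta1 B A)). Qed.

(** Only the exponent of the outer power of an iterated expression can be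
    enlarged directly, so the two powers are exchanged in between. *)
Lemma left_symmetric_leq p k q l A B C D Y :
    (p <= k)%N -> (q <= l)%N -> left_symmetric Y p q ((B, A), (D, C)) ->
  delta l D C (triangle k B A Y) = 0.
Proof.
move=> lepk leql [/commutator_eq0 AC /commutator_eq0 BD _ sym].
rewrite -triangle_delta_comm //; apply: (triangle_eq0_leq p) => //.
by rewrite triangle_delta_comm //; apply: delta_eq0_leq sym.
Qed.

End Multiplications.

Theorem theorem1p1 (R : realType) (H : hilbertType R)
    (Hinf : infinite_dimensional H)
    (A1 A2 B1 B2 S1 S2 T1 T2 X : bounded_op H)
    (m1 m2 n1 n2 r1 r2 s1 s2 : nat)
    (m1_gt0 : (0 < m1)%N) (m2_gt0 : (0 < m2)%N)
    (n1_gt0 : (0 < n1)%N) (n2_gt0 : (0 < n2)%N)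
    (r1_gt0 : (0 < r1)%N) (r2_gt0 : (0 < r2)%N)
    (s1_gt0 : (0 < s1)%N) (s2_gt0 : (0 < s2)%N)
    (cA12 : commutator A1 A2 = 0) (cB12 : commutator B1 B2 = 0)
    (cA1T1 : commutator A1 T1 = 0) (cA2T2 : commutator A2 T2 = 0)
    (cB1S1 : commutator B1 S1 = 0) (cB2S2 : commutator B2 S2 = 0)
    (h_ii : left_symmetric X m1 n1 ((B1, A1), (B2, A2)))
    (h_iii : left_symmetric X r1 n2 ((S1, T1), (B2, A2)))
    (h_iv : left_symmetric X m2 s1 ((B1, A1), (S2, T2)))
    (h_v : left_symmetric X r2 s2 ((S1, T1), (S2, T2))) :
  left_symmetric X
    (maxn m1 m2 + maxn r1 r2 - 1)%N (maxn n1 n2 + maxn s1 s2 - 1)%N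
    ((S1 * B1, T1 * A1), (S2 * B2, T2 * A2)).
Proof.
have [/commutator_eq0 A12 /commutator_eq0 B12 _ _] := h_ii.
have [/commutator_eq0 T1A2 /commutator_eq0 S1B2 _ _] := h_iii.
have [/commutator_eq0 A1T2 /commutator_eq0 B1S2 _ _] := h_iv.
have [/commutator_eq0 T12 /commutator_eq0 S12 _ _] := h_v.
move/commutator_eq0: cA1T1 => A1T1; move/commutator_eq0: cA2T2 => A2T2.
move/commutator_eq0: cB1S1 => B1S1; move/commutator_eq0: cB2S2 => B2S2.
have comm_mul (a b c d : bounded_op H) : GRing.comm a c -> GRing.comm a d ->
    GRing.comm b c -> GRing.comm b d -> GRing.comm (a * b) (c * d).
  by move=> ac ad bc bd; apply: commrM; apply/commr_sym/commrM; apply/commr_sym.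
have TA : GRing.comm (T1 * A1) (T2 * A2) by exact: comm_mul.
have SB : GRing.comm (S1 * B1) (S2 * B2) by exact: comm_mul.
split; [exact: comm_commutator | exact: comm_commutator | |].
  exact: triangle_delta_comm.
rewrite -triangle_delta_comm //; apply: triangle_mul_eq0 => //.
- rewrite triangle_delta_comm; [|exact: commrM|exact: commrM].
  apply: delta_mul_eq0 => //.
  + by apply: left_symmetric_leq h_ii; rewrite leq_max leqnn.
  + by apply: left_symmetric_leq h_iv; rewrite leq_max leqnn ?orbT.
- rewrite triangle_delta_comm; [|exact: commrM|exact: commrM].
  apply: delta_mul_eq0 => //.
  + by apply: left_symmetric_leq h_iii; rewrite leq_max leqnn ?orbT.
  + by apply: left_symmetric_leq h_v; rewrite leq_max leqnn orbT.
Qed.
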